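(* Let $\omega_{11}=\frac{1}{2}(1+i\sqrt{11})$, let $\Gamma_{11}=PU(2,1;\mathcal{O}_{11})$ with $\mathcal{O}_{11}=\mathbb{Z}[\omega_{11}]$, and let $(\Gamma_{11})_\infty$ be the stabiliser of $q_\infty$ in $\Gamma_{11}$. Then $(\Gamma_{11})_\infty$ is generated by $$R_1=\begin{bmatrix}1&0&0\\0&-1&0\\0&0&1\end{bmatrix},\quad R_2=\begin{bmatrix}1&1&-\bar{\omega}_{11}\\0&-1&1\\0&0&1\end{bmatrix},\quad R_3=\begin{bmatrix}1&\bar{\omega}_{11}&-1-\bar{\omega}_{11}\\0&-1&\omega_{11}\\0&0&1\end{bmatrix}\quad\text{and}\quad T=\begin{bmatrix}1&0&i\sqrt{11}\\0&1&0\\0&0&1\end{bmatrix}.$$ A presentation is given by $$(\Gamma_{11})_\infty=\langle R_1,R_2,R_3,T\mid R_1^2=[T,R_1]=TR_2^{-2}=TR_3^{-2}=T(R_1R_3R_2)^{-2}=\mathrm{id}\rangle.$$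
   Context: $\mathbb{C}^{2,1}$ is $\mathbb{C}^3$ with the Hermitian form $\langle \mathbf{z},\mathbf{w}\rangle=z_1\bar{w}_3+z_2\bar{w}_2+z_3\bar{w}_1$. $U(2,1)$ is the group of $3\times 3$ complex matrices preserving this form, and $PU(2,1)=U(2,1)/U(1)$, where $U(1)=\{e^{i\theta}I\}$. $PU(2,1;\mathcal{O})$ denotes the subgroup of $PU(2,1)$ consisting of classes of matrices in $U(2,1)$ with all entries in the ring $\mathcal{O}$; matrices stand for their classes. $q_\infty$ is the point of the complex projective plane represented by the column vector $[1,0,0]^t$. $[a,b]$ denotes the commutator $aba^{-1}b^{-1}$. *)

(* Defs.v *)
From HB Require Import structures.
From mathcomp Require Import all_boot all_order all_algebra.
From mathcomp Require Import boolp reals trigo complex.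

Set Implicit Arguments.
Unset Strict Implicit.
Unset Printing Implicit Defensive.

Import Order.TTheory GRing.Theory Num.Theory.

Section Subgroups.
Variable G : groupType.
Local Open Scope group_scope.

Record subgroup := Subgroup {
  subgroup_pred :> {pred G};
  subgroup_closed : group_closed subgroup_pred }.

Record normalSubgroup := NormalSubgroup {
  normal_subgroup :> subgroup;
  normal_conj : forall x y : G, x \in normal_subgroup -> x ^ y \in normal_subgroup }.

Lemma subgroup1 (H : subgroup) : 1 \in H.
Proof. by case: (subgroup_closed H). Qed.

Lemma subgroupV (H : subgroup) x : x \in H -> x^-1 \in H.
Proof. exact: (group_closedV (subgroup_closed H)). Qed.

Lemma subgroupM (H : subgroup) x y : x \in H -> y \in H -> x * y \in H.
Proof. by move=> Hx Hy; apply: (group_closedM (subgroup_closed H)). Qed.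

Definition generates (I : Type) (g : I -> G) : Prop :=
  forall H : subgroup, (forall i, g i \in H) -> forall x : G, x \in H.

Section SubgroupType.
Variable H : subgroup.

Record subg_of := Subg { sgval : G; sgvalP : sgval \in H }.

HB.instance Definition _ := [isSub for sgval].
HB.instance Definition _ := [Choice of subg_of by <:].

Definition subg_one := Subg (subgroup1 H).
Definition subg_inv (x : subg_of) := Subg (subgroupV (sgvalP x)).
Definition subg_mul (x y : subg_of) := Subg (subgroupM (sgvalP x) (sgvalP y)).

Lemma subg_mulA : associative subg_mul.
Proof. by move=> x y z; apply: val_inj; apply: mulgA. Qed.
Lemma subg_mul1g : left_id subg_one subg_mul.
Proof. by move=> x; apply: val_inj; apply: mul1g. Qed.
Lemma subg_mulg1 : right_id subg_one subg_mul.
Proof. by move=> x; apply: val_inj; apply: mulg1. Qed.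
Lemma subg_mulVg : left_inverse subg_one subg_inv subg_mul.
Proof. by move=> x; apply: val_inj; apply: mulVg. Qed.
Lemma subg_mulgV : right_inverse subg_one subg_inv subg_mul.
Proof. by move=> x; apply: val_inj; apply: mulgV. Qed.

HB.instance Definition _ := isGroup.Build subg_of
  subg_mulA subg_mul1g subg_mulg1 subg_mulVg subg_mulgV.

End SubgroupType.

Section NormalClosure.
Variable X : G -> Prop.

Definition normal_closure_pred : {pred G} :=
  [pred x | `[< forall N : normalSubgroup, (forall r, X r -> r \in N) -> x \in N >]].

Lemma normal_closureP x :
  reflect (forall N : normalSubgroup, (forall r, X r -> r \in N) -> x \in N)
          (x \in normal_closure_pred).
Proof. exact: asboolP. Qed.

Lemma normal_closure_group : group_closed normal_closure_pred.
Proof.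
split=> [|x y /normal_closureP Hx /normal_closureP Hy]; apply/normal_closureP.
  by move=> N _; apply: subgroup1.
by move=> N HN; apply: subgroupM (Hx N HN) (subgroupV (Hy N HN)).
Qed.

Lemma normal_closure_conj x y :
  x \in Subgroup normal_closure_group -> x ^ y \in Subgroup normal_closure_group.
Proof.
move=> /normal_closureP Hx; apply/normal_closureP => N HN.
exact: normal_conj (Hx N HN).
Qed.

Definition normal_closure : normalSubgroup := NormalSubgroup normal_closure_conj.

End NormalClosure.

Section Quotient.
Variable N : normalSubgroup.

Definition lcoset_rel : rel G := fun x y => x^-1 * y \in N.

Lemma lcoset_refl : reflexive lcoset_rel.
Proof. by move=> x; rewrite /lcoset_rel mulVg subgroup1. Qed.
Lemma lcoset_sym : symmetric lcoset_rel.
Proof.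
by move=> x y; apply/idP/idP => /subgroupV; rewrite invgM invgK.
Qed.
Lemma lcoset_trans : transitive lcoset_rel.
Proof. by move=> y x z xy /(subgroupM xy); rewrite -mulgA mulVKg. Qed.

Definition lcoset_equiv := EquivRel lcoset_rel lcoset_refl lcoset_sym lcoset_trans.

Definition quotg := {eq_quot lcoset_equiv}%qT.

HB.instance Definition _ := Choice.on quotg.
HB.instance Definition _ := EqQuotient.on quotg.

Lemma quotgP (x y : G) : reflect (\pi_quotg x = \pi_quotg y)%qT (x^-1 * y \in N).
Proof. exact: (eqmodP lcoset_equiv). Qed.

Definition quotg_one : quotg := \pi%qT 1.
Definition quotg_inv (x : quotg) : quotg := \pi%qT (repr x)^-1.
Definition quotg_mul (x y : quotg) : quotg := \pi%qT (repr x * repr y).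

Lemma pi_quotgM (x y : G) :
  quotg_mul (\pi%qT x) (\pi%qT y) = \pi_quotg%qT (x * y).
Proof.
apply/quotgP; set x' := repr _; set y' := repr _.
have Hx : x'^-1 * x \in N by apply/quotgP; rewrite reprK.
have Hy : y'^-1 * y \in N by apply/quotgP; rewrite reprK.
have -> : (x' * y')^-1 * (x * y) = (x'^-1 * x) ^ y' * (y'^-1 * y).
  by rewrite conjgE invgM !mulgA mulgK.
by apply: subgroupM Hy; apply: normal_conj.
Qed.

Lemma pi_quotgV (x : G) : quotg_inv (\pi%qT x) = \pi_quotg%qT x^-1.
Proof.
apply/quotgP; set x' := repr _.
have /subgroupV Hx : x'^-1 * x \in N by apply/quotgP; rewrite reprK.
rewrite invgK; have := normal_conj x'^-1 Hx.
by rewrite conjgE invgM !invgK mulgK.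
Qed.

Lemma quotg_mulA : associative quotg_mul.
Proof.
move=> x y z; rewrite -[x]reprK -[y]reprK -[z]reprK.
by rewrite !pi_quotgM mulgA.
Qed.
Lemma quotg_mul1g : left_id quotg_one quotg_mul.
Proof. by move=> x; rewrite -[x]reprK pi_quotgM mul1g. Qed.
Lemma quotg_mulg1 : right_id quotg_one quotg_mul.
Proof. by move=> x; rewrite -[x]reprK pi_quotgM mulg1. Qed.
Lemma quotg_mulVg : left_inverse quotg_one quotg_inv quotg_mul.
Proof. by move=> x; rewrite -[x]reprK pi_quotgV pi_quotgM mulVg. Qed.
Lemma quotg_mulgV : right_inverse quotg_one quotg_inv quotg_mul.
Proof. by move=> x; rewrite -[x]reprK pi_quotgV pi_quotgM mulgV. Qed.

HB.instance Definition _ := isGroup.Build quotg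
  quotg_mulA quotg_mul1g quotg_mulg1 quotg_mulVg quotg_mulgV.

Definition class_of (x : G) : quotg := \pi%qT x.

Lemma class_ofM : {morph class_of : x y / x * y}.
Proof. by move=> x y; rewrite /class_of -pi_quotgM. Qed.

HB.instance Definition _ := isMultiplicative.Build G quotg class_of class_ofM.

Lemma class_of1 : class_of 1 = 1. Proof. by []. Qed.

Lemma class_ofV : {morph class_of : x / x^-1}.
Proof. by move=> x; rewrite /class_of -pi_quotgV. Qed.

Lemma class_ofP (x y : G) : reflect (class_of x = class_of y) (x^-1 * y \in N).
Proof. exact: quotgP. Qed.

Lemma class_of_surj (x : quotg) : exists y, class_of y = x.
Proof. by exists (repr x); apply: reprK. Qed.

End Quotient.
End Subgroups.

Section FreeGroup.
Variable S : choiceType.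

(* [(s, true)] is the letter [s] and [(s, false)] the letter [s^-1]. *)
Definition letter : Type := (S * bool)%type.
HB.instance Definition _ := Choice.on letter.

Definition letterV (l : letter) : letter := (l.1, ~~ l.2).

Lemma letterVK : involutive letterV.
Proof. by case=> s b; rewrite /letterV /= negbK. Qed.

Definition reduced (w : seq letter) : bool :=
  sorted (fun l m => m != letterV l) w.

Definition push (l : letter) (w : seq letter) : seq letter :=
  if w is m :: w' then if m == letterV l then w' else l :: w else [:: l].

Definition wmul (u v : seq letter) : seq letter := foldr push v u.
Definition winv (u : seq letter) : seq letter := rev (map letterV u).

Lemma push_reduced l w : reduced w -> reduced (push l w).
Proof.
case: w => [|m w] //= Hw; case: ifP => [_|H]; first exact: path_sorted Hw.
by rewrite /reduced /= H.
Qed.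

Lemma wmul_reduced u v : reduced v -> reduced (wmul u v).
Proof. by move=> Hv; elim: u => //= l u IH; apply: push_reduced. Qed.

Lemma pushK l w : reduced w -> push (letterV l) (push l w) = w.
Proof.
case: w => [|m w] /=; first by rewrite letterVK eqxx.
case: ifP => [/eqP -> |_ _] /=; last by rewrite letterVK eqxx.
by case: w => [|k w] //=; rewrite /reduced /= => /andP[/negPf ->].
Qed.

Lemma wmul_push l u w : reduced w -> wmul (push l u) w = push l (wmul u w).
Proof.
case: u => [|m u] //= Hw; case: ifP => [/eqP -> |_] //=.
by rewrite -{1}[l]letterVK pushK // wmul_reduced.
Qed.

Lemma wmulA u v w : reduced w -> wmul u (wmul v w) = wmul (wmul u v) w.
Proof. by move=> Hw; elim: u => //= l u ->; rewrite wmul_push. Qed.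

Lemma wmul1 u : reduced u -> wmul u [::] = u.
Proof.
elim: u => //= l [|m u] IH //=; rewrite /reduced /= => /andP[Hlm Hu].
by have /= -> := IH Hu; rewrite /= (negPf Hlm).
Qed.

Lemma winv_reduced u : reduced u -> reduced (winv u).
Proof.
rewrite /reduced /winv rev_sorted sorted_map; congr is_true; apply: eq_sorted.
by move=> l m /=; rewrite letterVK eq_sym.
Qed.

Lemma wmulV u : wmul (winv u) u = [::].
Proof.
rewrite /winv; elim: u => //= l u IH.
by rewrite rev_cons -cats1 /wmul foldr_cat /= letterVK eqxx.
Qed.

Lemma winvK : involutive winv.
Proof.
by move=> u; rewrite /winv map_rev revK -map_comp map_id_in // => l _ /=; rewrite letterVK.
Qed.

Record freeGroup := FreeGroup { fgval : seq letter; fgvalP : reduced fgval }.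

HB.instance Definition _ := [isSub for fgval].
HB.instance Definition _ := [Choice of freeGroup by <:].

Definition fg_one := @FreeGroup [::] isT.
Definition fg_mul (x y : freeGroup) :=
  FreeGroup (wmul_reduced (fgval x) (fgvalP y)).
Definition fg_inv (x : freeGroup) := FreeGroup (winv_reduced (fgvalP x)).

Lemma fg_mulA : associative fg_mul.
Proof. by move=> x y z; apply: val_inj; apply: wmulA; apply: fgvalP. Qed.
Lemma fg_mul1g : left_id fg_one fg_mul.
Proof. by move=> x; apply: val_inj. Qed.
Lemma fg_mulg1 : right_id fg_one fg_mul.
Proof. by move=> x; apply: val_inj; apply: wmul1; apply: fgvalP. Qed.
Lemma fg_mulVg : left_inverse fg_one fg_inv fg_mul.
Proof. by move=> x; apply: val_inj; apply: wmulV. Qed.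
Lemma fg_mulgV : right_inverse fg_one fg_inv fg_mul.
Proof.
by move=> x; apply: val_inj; rewrite /= -{1}[fgval x]winvK; apply: wmulV.
Qed.

HB.instance Definition _ := isGroup.Build freeGroup
  fg_mulA fg_mul1g fg_mulg1 fg_mulVg fg_mulgV.

Definition fgen (s : S) : freeGroup := @FreeGroup [:: (s, true)] isT.

Definition presented (rels : seq freeGroup) : groupType :=
  quotg (normal_closure (fun r => r \in rels)).

(* The assignment [s |-> g s] induces an isomorphism from < S | rels > onto G. *)
Definition presents (rels : seq freeGroup) (G : groupType) (g : S -> G) : Prop :=
  exists f : {multiplicative presented rels -> G},
    bijective f /\ forall s : S, f (class_of _ (fgen s)) = g s.

End FreeGroup.

Section Unitary.
Variable R : realType.
Local Notation C := R[i].
Local Open Scope ring_scope.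

Definition herm (z w : 'cV[C]_3) : C :=
  z 0 0 * (w 2 0)^*%C + z 1 0 * (w 1 0)^*%C + z 2 0 * (w 0 0)^*%C.

Definition unitary21 : {pred 'M[C]_3} :=
  [pred A | `[< forall z w, herm (A *m z) (A *m w) = herm z w >]].

Lemma unitary21P (A : 'M[C]_3) :
  reflect (forall z w, herm (A *m z) (A *m w) = herm z w) (A \in unitary21).
Proof. exact: asboolP. Qed.

Lemma herm_deltar z i : herm z (delta_mx (rev_ord i) 0) = z i 0.
Proof.
rewrite /herm !mxE; case: i => [[|[|[|//]]] Hi] /=.
all: rewrite oppr0 ?mulr0 ?mulr1 ?add0r ?addr0.
all: by congr (z _ _); apply: val_inj.
Qed.

Lemma herm_deltal w i : herm (delta_mx i 0) w = (w (rev_ord i) 0)^*%C.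
Proof.
rewrite /herm !mxE; case: i => [[|[|[|//]]] Hi] /=.
all: rewrite ?mul0r ?mul1r ?add0r ?addr0.
all: by congr (_ (w _ _)); apply: val_inj.
Qed.

Lemma herm_nondeg (z : 'cV[C]_3) : (forall w, herm z w = 0) -> z = 0.
Proof. by move=> Hz; apply/colP => i; rewrite -herm_deltar Hz mxE. Qed.

Lemma unitary21_unit (A : 'M[C]_3) : A \in unitary21 -> A \in unitmx.
Proof.
move=> /unitary21P HA; rewrite -unitmx_tr -row_free_unit.
apply: inj_row_free => v vA0; apply: trmx_inj; rewrite trmx0.
apply: herm_nondeg => w; rewrite -HA -[A]trmxK -trmx_mul vA0 trmx0.
by rewrite /herm !mxE !mul0r !addr0.
Qed.

Record U21 := MkU21 { umx : 'M[C]_3; umxP : umx \in unitary21 }.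

HB.instance Definition _ := [isSub for umx].
HB.instance Definition _ := [Choice of U21 by <:].

Lemma unitary21_one : 1%:M \in unitary21.
Proof. by apply/unitary21P => z w; rewrite !mul1mx. Qed.

Lemma unitary21_mul A B :
  A \in unitary21 -> B \in unitary21 -> A *m B \in unitary21.
Proof.
by move=> /unitary21P HA /unitary21P HB; apply/unitary21P => z w;
  rewrite -!mulmxA HA HB.
Qed.

Lemma unitary21_inv A : A \in unitary21 -> invmx A \in unitary21.
Proof.
move=> HA; have Au := unitary21_unit HA; move/unitary21P: HA => HA.
by apply/unitary21P => z w; rewrite -HA !mulmxA mulmxV // !mul1mx.
Qed.

Lemma unitary21_invE A i j : A \in unitary21 ->
  invmx A i j = (A (rev_ord j) (rev_ord i))^*%C.
Proof.
move=> HA; have Au := unitary21_unit HA; move/unitary21P: (HA) => HAf.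
have colE (B : 'M[C]_3) k l : (B *m delta_mx k 0 : 'cV_3) l 0 = B l k.
  by rewrite -colE mxE.
rewrite -[LHS]colE -[LHS]herm_deltar -[LHS]HAf mulmxA mulmxV // mul1mx herm_deltal.
by rewrite colE.
Qed.

Definition u21_one := MkU21 unitary21_one.
Definition u21_mul (A B : U21) := MkU21 (unitary21_mul (umxP A) (umxP B)).
Definition u21_inv (A : U21) := MkU21 (unitary21_inv (umxP A)).

Lemma u21_mulA : associative u21_mul.
Proof. by move=> x y z; apply: val_inj; apply: mulmxA. Qed.
Lemma u21_mul1g : left_id u21_one u21_mul.
Proof. by move=> x; apply: val_inj; apply: mul1mx. Qed.
Lemma u21_mulg1 : right_id u21_one u21_mul.
Proof. by move=> x; apply: val_inj; apply: mulmx1. Qed.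
Lemma u21_mulVg : left_inverse u21_one u21_inv u21_mul.
Proof. by move=> x; apply: val_inj; apply/mulVmx/unitary21_unit/umxP. Qed.
Lemma u21_mulgV : right_inverse u21_one u21_inv u21_mul.
Proof. by move=> x; apply: val_inj; apply/mulmxV/unitary21_unit/umxP. Qed.

HB.instance Definition _ := isGroup.Build U21
  u21_mulA u21_mul1g u21_mulg1 u21_mulVg u21_mulgV.

Lemma umxM (A B : U21) : umx (A * B)%g = umx A *m umx B. Proof. by []. Qed.
Lemma umx1 : umx 1%g = 1%:M. Proof. by []. Qed.
Lemma umxV (A : U21) : umx A^-1%g = invmx (umx A). Proof. by []. Qed.

Definition expi (t : R) : C := (cos t +i* sin t)%C.

Lemma expi0 : expi 0 = 1. Proof. by rewrite /expi cos0 sin0. Qed.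
Lemma expiD a b : expi (a + b) = expi a * expi b.
Proof.
rewrite /expi cosD sinD; apply/eqP; rewrite eq_complex /=.
by rewrite eqxx /= addrC.
Qed.
Lemma expi_neq0 t : expi t != 0.
Proof.
apply/eqP => E; have := expiD t (- t); rewrite subrr expi0 E mul0r.
exact/eqP/oner_neq0.
Qed.
Lemma expiN t : expi (- t) = (expi t)^-1.
Proof.
by apply: (mulfI (expi_neq0 t)); rewrite -expiD subrr expi0 divff ?expi_neq0.
Qed.

Definition u1_pred : {pred U21} :=
  [pred A | `[< exists t : R, umx A = (expi t)%:M >]].

Lemma u1P A : reflect (exists t : R, umx A = (expi t)%:M) (A \in u1_pred).
Proof. exact: asboolP. Qed.

Lemma u1_group : group_closed u1_pred.
Proof.
split=> [|A B /u1P[a Ha] /u1P[b Hb]]; apply/u1P.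
  by exists 0; rewrite expi0.
exists (a - b); rewrite umxM umxV Ha Hb expiD expiN.
by rewrite invmx_scalar -scalar_mxM.
Qed.

Lemma u1_conj A B : A \in Subgroup u1_group -> (A ^ B)%g \in Subgroup u1_group.
Proof.
move=> /u1P[t Ht]; apply/u1P; exists t; rewrite conjgE !umxM Ht -scalar_mxC.
by rewrite mulmxA -umxM mulVg mul1mx.
Qed.

Definition U1 : normalSubgroup U21 := NormalSubgroup u1_conj.

Definition PU21 : groupType := quotg U1.

Record vec := Vec { vval : 'cV[C]_3; vvalP : vval != 0 }.

HB.instance Definition _ := [isSub for vval].
HB.instance Definition _ := [Choice of vec by <:].

Definition prop_rel : rel vec :=
  fun u v => `[< exists2 c : C, c != 0 & vval v = c *: vval u >].

Lemma prop_refl : reflexive prop_rel.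
Proof. by move=> u; apply/asboolP; exists 1; rewrite ?oner_neq0 ?scale1r. Qed.
Lemma prop_symW u v : prop_rel u v -> prop_rel v u.
Proof.
move=> /asboolP[c c0 Hc]; apply/asboolP; exists c^-1; first by rewrite invr_eq0.
by rewrite Hc scalerA mulVf // scale1r.
Qed.
Lemma prop_sym : symmetric prop_rel.
Proof. by move=> u v; apply/idP/idP; apply: prop_symW. Qed.
Lemma prop_trans : transitive prop_rel.
Proof.
move=> v u w /asboolP[c c0 Hc] /asboolP[d d0 Hd]; apply/asboolP.
by exists (d * c); rewrite ?mulf_neq0 // Hd Hc scalerA.
Qed.

Definition prop_equiv := EquivRel prop_rel prop_refl prop_sym prop_trans.

Definition CP2 := {eq_quot prop_equiv}%qT.

HB.instance Definition _ := Choice.on CP2.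
HB.instance Definition _ := EqQuotient.on CP2.

Definition point_of (v : vec) : CP2 := \pi%qT v.

Lemma point_ofP (u v : vec) :
  point_of u = point_of v <-> exists2 c : C, c != 0 & vval v = c *: vval u.
Proof.
by split=> [/(eqmodP prop_equiv)/asboolP|H] //; apply/(eqmodP prop_equiv)/asboolP.
Qed.

Lemma uapp_subproof (A : U21) (v : vec) : umx A *m vval v != 0.
Proof.
apply: contra (vvalP v) => /eqP E; rewrite -[vval v]mul1mx -umx1.
by rewrite -(mulVg A) umxM -mulmxA E mulmx0.
Qed.

Definition uapp (A : U21) (v : vec) : vec := Vec (uapp_subproof A v).

(* Computed on representatives; [pactE] shows that the choice is immaterial. *)
Definition pact (g : PU21) (p : CP2) : CP2 := point_of (uapp (repr g) (repr p)).

Lemma pactE (A : U21) (v : vec) :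
  pact (class_of U1 A) (point_of v) = point_of (uapp A v).
Proof.
rewrite /pact; set B := repr _; set u := repr _.
have /class_ofP/u1P[t Ht] : class_of U1 B = class_of U1 A by apply: reprK.
have /point_ofP[c c0 Hc] : point_of u = point_of v by apply: reprK.
apply/point_ofP; exists (expi t * c); first by rewrite mulf_neq0 ?expi_neq0.
rewrite /= -[A](mulVKg B) umxM Ht Hc mul_mx_scalar.
by rewrite -scalemxAl -scalemxAr scalerA.
Qed.

Definition omega11 : C := (1 + 'i%C * (Num.sqrt 11)%:C%C) / 2.

Definition O11 : {pred C} :=
  [pred z | `[< exists p : {poly int}, z = (map_poly intr p).[omega11] >]].

Lemma O11P z :
  reflect (exists p : {poly int}, z = (map_poly intr p).[omega11]) (z \in O11).
Proof. exact: asboolP. Qed.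

Lemma O11_int (n : int) : n%:~R \in O11.
Proof. by apply/O11P; exists n%:P; rewrite map_polyC hornerC. Qed.

Lemma O11D x y : x \in O11 -> y \in O11 -> x + y \in O11.
Proof.
by move=> /O11P[p ->] /O11P[q ->]; apply/O11P; exists (p + q);
  rewrite rmorphD hornerD.
Qed.

Lemma O11M x y : x \in O11 -> y \in O11 -> x * y \in O11.
Proof.
by move=> /O11P[p ->] /O11P[q ->]; apply/O11P; exists (p * q);
  rewrite rmorphM hornerM.
Qed.

Lemma conj_omega11 : omega11^*%C = 1 - omega11.
Proof.
have E : omega11^*%C + omega11 = 1.
  rewrite /omega11 rmorphM fmorphV rmorphD rmorph1 rmorph_nat rmorphM /=.
  rewrite oppr0 (_ : Complex 0 (-1) = - 'i%C); last first.
    by apply/eqP; rewrite eq_complex /= oppr0 !eqxx.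
  by rewrite -mulrDl mulNr addrACA addNr addr0 -[1 + 1]/(2%:R) divff ?pnatr_eq0.
by rewrite -E addrK.
Qed.

Lemma O11_conj x : x \in O11 -> x^*%C \in O11.
Proof.
move=> /O11P[p ->]; apply/O11P; exists (p \Po (1 - 'X)).
rewrite map_comp_poly rmorphB /= rmorph1 map_polyX horner_comp !hornerE.
rewrite -horner_map -[X in _.[X] = _]/(omega11^*%C) conj_omega11.
rewrite -map_poly_comp; congr (_.[_]); apply: eq_map_poly => n.
exact: rmorph_int.
Qed.

Definition gamma11_pred : {pred PU21} :=
  [pred g | `[< exists A : U21,
                  class_of U1 A = g /\ forall i j, umx A i j \in O11 >]].

Lemma gamma11P g :
  reflect (exists A : U21, class_of U1 A = g /\ forall i j, umx A i j \in O11)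
          (g \in gamma11_pred).
Proof. exact: asboolP. Qed.

Lemma gamma11_group : group_closed gamma11_pred.
Proof.
split=> [|g h /gamma11P[A [<- HA]] /gamma11P[B [<- HB]]]; apply/gamma11P.
  exists 1%g; split=> // i j; rewrite umx1 mxE.
  by case: eqP => _; [apply: (O11_int 1)|apply: (O11_int 0)].
exists (A / B)%g; split=> [|i j]; first by rewrite class_ofM class_ofV.
rewrite umxM mxE; apply: (big_ind (fun z => z \in O11)).
- exact: (O11_int 0).
- exact: O11D.
move=> k _; apply: O11M => //.
by rewrite umxV unitary21_invE ?umxP //; apply: O11_conj.
Qed.

Definition Gamma11 : groupType := subg_of (Subgroup gamma11_group).

Lemma qinf_subproof : delta_mx 0 0 != 0 :> 'cV[C]_3.
Proof. by apply/eqP => /colP/(_ 0)/eqP; rewrite !mxE oner_eq0. Qed.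

Definition qinf : CP2 := point_of (Vec qinf_subproof).

Lemma pact1 p : pact 1%g p = p.
Proof.
rewrite -[p]reprK -[\pi%qT _]/(point_of _) -class_of1 pactE.
by apply/point_ofP; exists 1; rewrite ?oner_neq0 //= mul1mx scale1r.
Qed.

Lemma pactM g h p : pact (g * h)%g p = pact g (pact h p).
Proof.
have [[A <-] [B <-]] := (class_of_surj g, class_of_surj h).
rewrite -[p]reprK -[\pi%qT _]/(point_of _) -class_ofM !pactE.
by apply/point_ofP; exists 1; rewrite ?oner_neq0 //= mulmxA scale1r.
Qed.

Definition stab_qinf_pred : {pred Gamma11} :=
  [pred g | pact (sgval g) qinf == qinf].

Lemma stab_qinf_group : group_closed stab_qinf_pred.
Proof.
split=> [|g h /eqP Hg /eqP Hh]; apply/eqP; first exact: pact1.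
have Hv : pact (sgval h)^-1%g qinf = qinf by rewrite -{1}Hh -pactM mulVg pact1.
by rewrite /= pactM Hv.
Qed.

Definition Gamma11_inf : groupType := subg_of (Subgroup stab_qinf_group).

Definition represents (M : 'M[C]_3) (g : Gamma11_inf) : Prop :=
  exists A : U21, umx A = M /\ class_of U1 A = sgval (sgval g).

Definition mx3 (a b c d e f g h k : C) : 'M[C]_3 :=
  \matrix_(i, j) nth 0 (nth [::] [:: [:: a; b; c]; [:: d; e; f]; [:: g; h; k]] i) j.

Definition R1_mx : 'M[C]_3 := mx3
  1    0    0
  0  (- 1)  0
  0    0    1.

Definition R2_mx : 'M[C]_3 := mx3
  1    1    (- omega11^*%C)
  0  (- 1)  1
  0    0    1.

Definition R3_mx : 'M[C]_3 := mx3
  1  (omega11^*%C)  (- 1 - omega11^*%C)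
  0  (- 1)          omega11
  0    0            1.

Definition T_mx : 'M[C]_3 := mx3
  1  0  ('i%C * (Num.sqrt 11)%:C%C)
  0  1  0
  0  0  1.

End Unitary.

Section Relators.
Local Open Scope group_scope.

(* The free generators 0, 1, 2, 3 stand for R_1, R_2, R_3, T. *)
Let r1 := fgen (0%R : 'I_4).
Let r2 := fgen (1%R : 'I_4).
Let r3 := fgen (2%R : 'I_4).
Let t := fgen (3%R : 'I_4).

Definition relators : seq (freeGroup 'I_4) :=
  [:: r1 ^+ 2;
      t * r1 * t^-1 * r1^-1;
      t * r2 ^- 2;
      t * r3 ^- 2;
      t * (r1 * r3 * r2) ^- 2].

End Relators.

(* Main.v *)
Require Import Defs.
From HB Require Import structures.
From mathcomp Require Import all_boot all_order all_algebra reals.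
From mathcomp Require Import boolp trigo complex zify ring.

Set Implicit Arguments.
Unset Strict Implicit.
Unset Printing Implicit Defensive.

Import Order.TTheory GRing.Theory Num.Theory.

(** An isometry with entries in O_11 that fixes q_infty is upper triangular,
    and its diagonal entries are units of O_11, that is 1 or -1.  So modulo
    scalars an element of the stabiliser is a matrix
      [1, -b conj(z), t; 0, b, z; 0, 0, 1]
    with b = 1 or b = -1, z and t in O_11, and t + conj(t) = -|z|^2.
    Forgetting t maps the stabiliser onto the group of maps u |-> b u + z of
    O_11, a copy of Z^2 extended by the half-turn; the kernel is the infinite
    cyclic group generated by the vertical translation T.

    Generation and presentation both come from one normal form.  Put
    A = R2 R1 and C = R3 R1, which lift the translations by 1 and by omega.
    The defining relations make T central, and they rewrite as
      R1 A = A^-1 T R1,    R1 C = C^-1 T R1,    C A = A T C,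
    the last one being the content of T = (R1 R3 R2)^2.  So in any group
    generated by four elements satisfying them, each element is
    A^x C^y T^k R1^e with x, y, k integers and e a bit
    ([normal_form_cover]).  In the stabiliser such a word is an explicit
    matrix [heis x y k e], in which z = x + y omega is read off first, then e,
    then k; hence different words give different elements ([heis_inj]).
    Conversely every stabiliser matrix is of this shape
    ([stabilizer_normal_form]): once z is known, t + conj(t) = -|z|^2
    determines t in O_11 up to integer multiples of i sqrt(11), which the
    powers of T supply.  Thus the map from the presented group is bijective. *)

(** * Integer powers *)

Section IntegerPowers.
Variable G : groupType.
Implicit Types (g h t : G) (m n : int).
Local Open Scope group_scope.

Definition zpow g n : G :=
  match n with Posz k => g ^+ k | Negz k => g ^- k.+1 end.

Lemma zpowS g n : zpow g (n + 1)%R = g * zpow g n.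
Proof.
case: n => [k|[|k]].
- have -> : (Posz k + 1 = Posz k.+1)%R by lia.
  by rewrite /= expgS.
- by rewrite /= mulgV.
have -> : (Negz k.+1 + 1 = Negz k)%R by lia.
by rewrite /= [in RHS]expgSr invgM mulVKg.
Qed.

(** The laws of exponents below are instances of this uniqueness principle for
    first-order recurrences, which spares case distinctions on signs. *)
Lemma zpow_rec g (F : int -> G) :
  (forall n, F (n + 1)%R = g * F n) -> forall n, F n = zpow g n * F 0%R.
Proof.
move=> FS; elim/int_ind=> [|k IH|k IH]; first by rewrite mul1g.
  by rewrite -addn1 PoszD FS IH zpowS mulgA.
apply: (mulgI g); rewrite mulgA -zpowS -FS.
by have -> : (- k.+1%:Z + 1 = - k%:Z)%R by lia.
Qed.

Lemma zpowD g m n : zpow g (m + n)%R = zpow g m * zpow g n.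
Proof.
rewrite -[n in RHS]add0r; apply: (zpow_rec (F := fun m => zpow g (m + n)%R)).
by move=> k; rewrite addrAC zpowS.
Qed.

Lemma zpow_semiconj h g g' n :
  h * g = g' * h -> h * zpow g n = zpow g' n * h.
Proof.
move=> E; rewrite -[h in RHS]mulg1 -[1]/(zpow g 0%R).
by apply: (zpow_rec (F := fun n => h * zpow g n)) => k; rewrite zpowS !mulgA E.
Qed.

Lemma zpowM g h n : commute g h -> zpow (g * h) n = zpow g n * zpow h n.
Proof.
move=> gh; rewrite -[LHS]mulg1 -[X in _ * X](mulg1 1).
apply/esym/(zpow_rec (F := fun n => zpow g n * zpow h n)) => k.
rewrite !zpowS -!mulgA; congr (g * _).
by rewrite !mulgA (zpow_semiconj k (esym gh)).
Qed.

Lemma zpowV g n : zpow g^-1 n = zpow g (- n)%R.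
Proof.
rewrite -[LHS]mulg1.
apply/esym/(zpow_rec (F := fun n => zpow g (- n)%R)) => k.
by apply: (mulgI g); rewrite mulVKg -zpowS opprD subrK.
Qed.

Lemma zpow_closed (H : subgroup G) g n : g \in H -> zpow g n \in H.
Proof.
move=> Hg; elim/int_ind: n => [|k IH|k IH]; first exact: subgroup1.
  by rewrite -addn1 PoszD zpowS subgroupM.
rewrite -[zpow _ _](mulKg g) -zpowS.
have -> : (- k.+1%:Z + 1 = - k%:Z)%R by lia.
by rewrite subgroupM // subgroupV.
Qed.

End IntegerPowers.

Lemma zpow_morph (G H : groupType) (f : UMagmaMorphism.type G H) g n :
  f (zpow g n) = zpow (f g) n.
Proof. by case: n => k /=; rewrite ?gmulfXVn ?gmulfXn. Qed.

(* A multiplicative map does not carry preservation of 1 in its structure, and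
   the morphism lemmas on powers and inverses ask for it. *)
HB.instance Definition _ (G : groupType) (N : normalSubgroup G) :=
  Multiplicative_isUMagmaMorphism.Build G (quotg N) (class_of N) (class_of1 N).

(** * Free and presented groups *)

Section FreeAndPresented.
Variables (S : choiceType) (G : groupType) (g : S -> G).
Local Open Scope group_scope.

Definition letter_eval (l : letter S) : G := if l.2 then g l.1 else (g l.1)^-1.

Definition word_eval (w : seq (letter S)) : G :=
  foldr (fun l x => letter_eval l * x) 1 w.

Lemma word_eval_push l w : word_eval (push l w) = letter_eval l * word_eval w.
Proof.
case: w => [|m w] //=; case: ifP => [/eqP -> |_] //=.
by rewrite mulgA; case: l => s [] /=; rewrite /letter_eval /= ?mulgV ?mulVg mul1g.
Qed.

Definition free_eval (x : freeGroup S) : G := word_eval (fgval x).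

Lemma free_evalM : {morph free_eval : x y / x * y}.
Proof.
case=> u Hu [v Hv]; rewrite /free_eval /=.
by elim: u {Hu} => [|l u IH] /=; rewrite ?mul1g // word_eval_push IH mulgA.
Qed.

Lemma free_eval1 : free_eval 1 = 1. Proof. by []. Qed.

HB.instance Definition _ :=
  isMultiplicative.Build (freeGroup S) G free_eval free_evalM.
HB.instance Definition _ :=
  Multiplicative_isUMagmaMorphism.Build (freeGroup S) G free_eval free_eval1.

Lemma free_eval_gen s : free_eval (fgen s) = g s.
Proof. exact: mulg1. Qed.

Lemma free_group_generated (H : subgroup (freeGroup S)) :
  (forall s, fgen s \in H) -> forall x, x \in H.
Proof.
move=> Hg [w Hw]; elim: w Hw => [|l w IH] Hw.
  by rewrite (_ : FreeGroup _ = 1) ?subgroup1 //; apply: val_inj.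
have Hw' : reduced w by move: Hw; case: w {IH} => [|m w] //= /andP[].
pose x := if l.2 then fgen l.1 else (fgen l.1)^-1.
have Hx : x \in H by rewrite /x; case: l.2; rewrite ?subgroupV.
rewrite (_ : FreeGroup Hw = x * FreeGroup Hw') ?subgroupM //.
apply: val_inj; rewrite /x; case: l Hw {x Hx} => s [] Hw /=.
all: by case: w Hw {IH Hw'} => [|m w] //= /andP[/negPf ->].
Qed.

(** The subgroups of a quotient pull back to subgroups of the free group. *)
Lemma presented_generated (rels : seq (freeGroup S)) (H : subgroup (presented rels)) :
  (forall s, class_of _ (fgen s) \in H) -> forall x, x \in H.
Proof.
move=> Hg x; have [y <-] := class_of_surj x.
pose K := [pred z | class_of (normal_closure (fun r => r \in rels)) z \in H].
have K_group : group_closed K.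
  split=> [|u v]; rewrite !inE; first by rewrite gmulf1 subgroup1.
  by move=> Hu Hv; rewrite gmulfF subgroupM ?subgroupV.
exact: (free_group_generated (H := Subgroup K_group)).
Qed.

(** The universal property: the kernel of evaluation is a normal subgroup
    containing the relators, hence their normal closure, so evaluation does not
    depend on the representative. *)
Lemma presented_lift (rels : seq (freeGroup S)) :
  (forall r, r \in rels -> free_eval r = 1) ->
  exists f : UMagmaMorphism.type (presented rels) G,
    forall s, f (class_of _ (fgen s)) = g s.
Proof.
move=> Hrels; pose N := normal_closure (fun r => r \in rels).
pose K := [pred x | free_eval x == 1].
have K_group : group_closed K.
  split=> [|u v]; rewrite !inE; first by rewrite gmulf1.
  by move=> /eqP Hu /eqP Hv; rewrite gmulfF /= Hu Hv divg1.
have K_conj x y : x \in Subgroup K_group -> x ^ y \in Subgroup K_group.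
  by move=> /eqP Hx; apply/eqP; rewrite gmulfJ /= Hx conj1g.
have N_ker x : x \in N -> free_eval x = 1.
  by move=> /normal_closureP/(_ (NormalSubgroup K_conj)) H; apply/eqP/H => r /Hrels/eqP.
pose f (x : presented rels) : G := free_eval (repr x).
have fE x : f (class_of N x) = free_eval x.
  have /class_ofP/N_ker : class_of N (repr (class_of N x)) = class_of N x.
    by apply: reprK.
  by rewrite gmulfM gmulfV => /mulg1_eq; rewrite invgK.
have fM : {morph f : x y / x * y}.
  move=> x y; have [[u <-] [v <-]] := (class_of_surj x, class_of_surj y).
  by rewrite -gmulfM !fE gmulfM.
have f1 : f 1 = 1 by rewrite -(class_of1 N) fE gmulf1.
pose fm := HB.pack_for (UMagmaMorphism.type (presented rels) G) f
  (isMultiplicative.Build (presented rels) G f fM)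
  (Multiplicative_isUMagmaMorphism.Build (presented rels) G f f1).
by exists fm => s; rewrite /fm /= fE free_eval_gen.
Qed.

End FreeAndPresented.

(** * Normal forms in groups satisfying the relations *)

Lemma ord4P (i : 'I_4) : [\/ i = 0%R, i = 1%R, i = 2%R | i = 3%R].
Proof.
by case: i => [[|[|[|[|//]]]] Hi]; [apply: Or41|apply: Or42|apply: Or43|apply: Or44];
  apply: val_inj.
Qed.

Section NormalForms.
Variables (G : groupType) (r : 'I_4 -> G).
Local Open Scope group_scope.

Let r1 := r 0%R.
Let r2 := r 1%R.
Let r3 := r 2%R.
Let t := r 3%R.

(** The equations expressed by the relators, for elements of an arbitrary
    group: both the presented group and the stabiliser satisfy them. *)
Definition relations : Prop :=
  [/\ r1 ^+ 2 = 1, commute t r1, t = r2 ^+ 2, t = r3 ^+ 2 & t = (r1 * r3 * r2) ^+ 2].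

(** Stated for a morphism out of the free group so as to serve twice: with the
    evaluation in the stabiliser and with the projection to the presented
    group. *)
Lemma relationsP (f : UMagmaMorphism.type (freeGroup 'I_4) G) :
  (forall i, f (fgen i) = r i) ->
  relations <-> (forall w, w \in relators -> f w = 1).
Proof.
move=> fr; pose P := fun w => f w = 1.
have -> : (forall w, w \in relators -> f w = 1) <-> foldr and True (map P relators).
  rewrite /relators /=; split=> [H|[H1 [H2 [H3 [H4 [H5 _]]]]] w].
    by do ![split]; apply: H; rewrite !inE eqxx ?orbT.
  by rewrite !inE => /or4P[/eqP->|/eqP->|/eqP->|/orP[]/eqP->].
rewrite /= /P !(gmulfM, gmulfXVn, gmulfXn, gmulfV) !fr -/r1 -/r2 -/r3 -/t.
split=> [[H1 H2 H3 H4 H5]|[H1 [/divg1_eq H2 [/divg1_eq H3 [/divg1_eq H4 [/divg1_eq H5 _]]]]]].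
  by rewrite -H3 -H4 -H5 !mulgV H2 !mulgK mulgV.
by split=> //; rewrite /commute -{2}H2 mulgVK.
Qed.

(** In the stabiliser these lift the translations by 1 and by omega, because
    each of the three half-turns r1, r2, r3 acts as u |-> - u + const. *)
Definition transl1 : G := r2 * r1.
Definition transl2 : G := r3 * r1.

Definition normal_form (x y k : int) (e : bool) : G :=
  zpow transl1 x * zpow transl2 y * zpow t k * r1 ^+ e.

Lemma normal_form_closed (H : subgroup G) x y k e :
  (forall i, r i \in H) -> normal_form x y k e \in H.
Proof.
move=> Hg; have [H1 H2 H3 Ht] : [/\ r1 \in H, r2 \in H, r3 \in H & t \in H].
  by split; apply: Hg.
by rewrite /normal_form expgb; case: e; rewrite !(subgroupM, zpow_closed, subgroup1).
Qed.

Hypothesis Hr : relations.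
Local Notation a := transl1.
Local Notation c := transl2.

Lemma r1_sqr : r1 * r1 = 1. Proof. by case: Hr; rewrite expg2. Qed.
Lemma t_eq_r2_sqr : t = r2 * r2. Proof. by case: Hr; rewrite -expg2. Qed.
Lemma t_eq_r3_sqr : t = r3 * r3. Proof. by case: Hr; rewrite -expg2. Qed.
(** With the next two lemmas: t is central. *)
Lemma commute_t_r1 : commute t r1. Proof. by case: Hr. Qed.
Lemma commute_t_r2 : commute t r2. Proof. by rewrite /commute t_eq_r2_sqr mulgA. Qed.
Lemma commute_t_r3 : commute t r3. Proof. by rewrite /commute t_eq_r3_sqr mulgA. Qed.

Lemma commute_t_transl1 : commute t a.
Proof. exact: commuteM commute_t_r2 commute_t_r1. Qed.
Lemma commute_t_transl2 : commute t c.
Proof. exact: commuteM commute_t_r3 commute_t_r1. Qed.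

(** Conjugation by r1 inverts a translation up to a vertical one, since
    s^-1 t = s for a half-turn s with s^2 = t. *)
Lemma r1_transl s : t = s * s -> r1 * (s * r1) = (s * r1)^-1 * t * r1.
Proof.
by move=> ts; rewrite invgM ts (mulg1_eq r1_sqr) !mulgA mulgVK.
Qed.

(** The Heisenberg commutation rule.  This is where the relator involving
    r1 r3 r2 is used. *)
Lemma transl_commutator : c * a = a * t * c.
Proof.
have tE : r1 * r3 * r2 * (r1 * r3 * r2) = t by case: Hr => _ _ _ _ ->.
have E : r3 * r2 * r1 * r3 * r2 = r1 * t by rewrite -tE !mulgA r1_sqr mul1g.
have E' : r2 * r1 * r3 * r2 = r3 * r1.
  by apply: (mulgI r3); rewrite !mulgA E -t_eq_r3_sqr commute_t_r1.
rewrite /transl1 /transl2 !mulgA; congr (_ * r1).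
by rewrite -E' -!mulgA -t_eq_r2_sqr commute_t_r3.
Qed.

Lemma commute_zpow (s s' : G) m n : commute s s' -> commute (zpow s m) (zpow s' n).
Proof.
by move=> ss'; apply: zpow_semiconj; apply/commute_sym/zpow_semiconj/commute_sym.
Qed.

Lemma r1_zpow s n : commute t s -> r1 * s = s^-1 * t * r1 ->
  r1 * zpow s n = zpow s (- n)%R * zpow t n * r1.
Proof.
move=> ts /zpow_semiconj ->; rewrite zpowM ?zpowV //.
exact/commute_sym/commuteV.
Qed.

Lemma normal_form_left_r1 x y k e :
  r1 * normal_form x y k e = normal_form (- x) (- y) (k + x + y)%R (~~ e).
Proof.
have t_r1 : commute (zpow t k) r1 by exact: (commute_zpow k 1%R commute_t_r1).
have tc : commute (zpow t x) (zpow c (- y)%R) by apply/commute_zpow/commute_t_transl2.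
rewrite /normal_form !mulgA (r1_zpow x commute_t_transl1 (r1_transl t_eq_r2_sqr)).
rewrite -(mulgA _ r1) (r1_zpow y commute_t_transl2 (r1_transl t_eq_r3_sqr)) !mulgA.
rewrite -(mulgA _ (zpow t x)) tc !mulgA -(mulgA _ r1) -t_r1 !mulgA.
have -> : (k + x + y = x + y + k)%R by rewrite -addrA addrC.
by rewrite !zpowD !mulgA !expgb; case: e; rewrite /= -!mulgA ?r1_sqr ?mulg1.
Qed.

Lemma normal_form_left_transl1 x y k e :
  a * normal_form x y k e = normal_form (x + 1)%R y k e.
Proof. by rewrite /normal_form zpowS !mulgA. Qed.

Lemma normal_form_left_transl2 x y k e :
  c * normal_form x y k e = normal_form x (y + 1)%R (k + x)%R e.
Proof.
have ca : c * zpow a x = zpow a x * zpow t x * c.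
  by rewrite (zpow_semiconj x transl_commutator) zpowM //; apply/commute_sym/commute_t_transl1.
have tc : commute (zpow t x) (zpow c (y + 1)%R) by apply/commute_zpow/commute_t_transl2.
rewrite /normal_form !mulgA {}ca (addrC k) (zpowD t); move: (transl2) tc => s tc.
by rewrite -!mulgA (mulgA s) -zpowS (mulgA (zpow t x)) tc !mulgA.
Qed.

Lemma normal_form_left_t x y k e :
  t * normal_form x y k e = normal_form x y (k + 1)%R e.
Proof.
have ta : commute t (zpow a x) by exact: (commute_zpow 1%R x commute_t_transl1).
have tc : commute t (zpow c y) by exact: (commute_zpow 1%R y commute_t_transl2).
by rewrite /normal_form !mulgA ta -(mulgA _ t) tc zpowS !mulgA.
Qed.

(** The elements whose left translation preserves the set of normal forms in
    both directions form a subgroup, which contains the generators by the four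
    multiplication rules above. *)
Lemma normal_form_cover : generates r ->
  forall g, exists x y k e, g = normal_form x y k e.
Proof.
pose Nf g := exists x y k e, g = normal_form x y k e.
pose K := [pred g | `[< forall h, Nf h <-> Nf (g * h) >]].
have K_group : group_closed K.
  split=> [|g h /asboolP Hg /asboolP Hh]; apply/asboolP => u; first by rewrite mul1g.
  by rewrite -mulgA -Hg (Hh (h^-1 * u)) mulVKg.
pose KG := Subgroup K_group.
have Kt : t \in KG.
  apply/asboolP => h; split=> [[x [y [k [e ->]]]]|[x [y [k [e E]]]]].
    by rewrite normal_form_left_t; do 4!eexists.
  exists x, y, (k - 1)%R, e; apply: (mulgI t).
  by rewrite E normal_form_left_t subrK.
have Kr1 : r1 \in KG.
  apply/asboolP => h; split=> [[x [y [k [e ->]]]]|[x [y [k [e E]]]]].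
    by rewrite normal_form_left_r1; do 4!eexists.
  rewrite -[h]mul1g -r1_sqr -mulgA E normal_form_left_r1; by do 4!eexists.
have Ka : a \in KG.
  apply/asboolP => h; split=> [[x [y [k [e ->]]]]|[x [y [k [e E]]]]].
    by rewrite normal_form_left_transl1; do 4!eexists.
  exists (x - 1)%R, y, k, e; apply: (mulgI a).
  by rewrite E normal_form_left_transl1 subrK.
have Kc : c \in KG.
  apply/asboolP => h; split=> [[x [y [k [e ->]]]]|[x [y [k [e E]]]]].
    by rewrite normal_form_left_transl2; do 4!eexists.
  exists x, (y - 1)%R, (k - x)%R, e; apply: (mulgI c).
  by rewrite E normal_form_left_transl2 !subrK.
have Kr2 : r2 \in KG by rewrite -[r2](mulgK r1) subgroupM ?subgroupV.
have Kr3 : r3 \in KG by rewrite -[r3](mulgK r1) subgroupM ?subgroupV.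
have Kr i : r i \in KG.
  by case: (ord4P i) => ->.
move=> /(_ KG Kr) gen g; have /asboolP/(_ 1) [] := gen g; rewrite mulg1 => + _; apply.
by exists 0%R, 0%R, 0%R, false; rewrite /normal_form /= !mulg1.
Qed.

End NormalForms.

(** * The ring of integers of Q(i sqrt 11) *)

Section RingO11.
Variable R : realType.
Local Notation C := R[i].
Local Open Scope ring_scope.
Local Notation w := (omega11 R).

Lemma omega11_sqr : w * w = w - 3.
Proof.
have s2 : ('i%C * (Num.sqrt 11)%:C%C : C) ^+ 2 = - 11.
  by rewrite exprMn sqr_i -rmorphXn /= sqr_sqrtr ?ler0n // rmorph_nat mulN1r.
rewrite /omega11; move: s2; set s := 'i%C * _; move=> s2.
have -> : (1 + s) / 2 * ((1 + s) / 2) = (1 + 2 * s + s ^+ 2) / 4 by field.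
by rewrite s2; field.
Qed.

Lemma sqrtN11 : 'i%C * (Num.sqrt 11)%:C%C = 2 * w - 1 :> C.
Proof. by rewrite /omega11; set s := 'i%C * _; field. Qed.

Lemma twice_omega11_sub1_neq0 : 2 * w - 1 != 0.
Proof.
apply/eqP => E; have : (2 * w - 1) * (2 * w - 1) = 4 * (w * w) - 4 * w + 1 by ring.
rewrite E mul0r omega11_sqr => F.
have : 11 = - (4 * (w - 3) - 4 * w + 1) :> C by ring.
by rewrite -F oppr0 => /eqP; rewrite pnatr_eq0.
Qed.

Definition zomega (x y : int) : C := x%:~R + y%:~R * w.

Lemma conj_zomega x y : (zomega x y)^*%C = x%:~R + y%:~R * (1 - w).
Proof.
by rewrite /zomega rmorphD rmorphM !rmorph_int; congr (_ + _ * _); apply: conj_omega11.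
Qed.

(** Subtracting the conjugate leaves y (2 omega - 1) = 0, and 2 omega - 1 has
    square -11. *)
Lemma zomega_eq0 x y : zomega x y = 0 -> x = 0 /\ y = 0.
Proof.
move=> E; have : (zomega x y)^*%C = 0 by rewrite E rmorph0.
rewrite conj_zomega => E'.
have : y%:~R * (2 * w - 1) = zomega x y - (x%:~R + y%:~R * (1 - w)) by rewrite /zomega; ring.
rewrite E E' subrr.
move/eqP; rewrite mulf_eq0 (negPf twice_omega11_sub1_neq0) orbF intr_eq0 => /eqP y0.
move: E; rewrite /zomega y0 mul0r addr0 => /eqP; rewrite intr_eq0 => /eqP.
by [].
Qed.

Lemma O11_zomega z : z \in @O11 R -> exists x y, z = zomega x y.
Proof.
move=> /O11P[p ->]; elim/poly_ind: p => [|p c [x [y IH]]].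
  by exists 0, 0; rewrite rmorph0 horner0 /zomega mul0r addr0.
exists (c - 3 * y), (x + y).
rewrite rmorphD rmorphM /= map_polyX map_polyC hornerD hornerM hornerX hornerC IH /zomega.
rewrite !(rmorphB, rmorphD, rmorphM) /=.
ring: omega11_sqr.
Qed.

(** The norm x^2 + xy + 3y^2 is multiplicative and nonnegative, so it is 1 on a
    unit; four times it is (2x + y)^2 + 11 y^2, which forces y = 0. *)
Lemma O11_unit u v : u \in @O11 R -> v \in @O11 R -> u * v = 1 -> u = 1 \/ u = - 1.
Proof.
move=> /O11_zomega[x [y ->]] /O11_zomega[x' [y' ->]] E.
have normE a b : zomega a b * (zomega a b)^*%C = (a * a + a * b + 3 * b * b)%:~R.
  rewrite conj_zomega /zomega !(rmorphD, rmorphM) /=; ring: omega11_sqr.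
have : (x * x + x * y + 3 * y * y) * (x' * x' + x' * y' + 3 * y' * y') = 1.
  apply/eqP; rewrite -(eqr_int C) rmorphM /= -!normE mulrACA -rmorphM E rmorph1 mulr1.
  by rewrite /=.
have : 4 * (x * x + x * y + 3 * y * y) = (2 * x + y) * (2 * x + y) + 11 * (y * y) by ring.
move: (_ + 3 * y * y) (_ + 3 * y' * y') => n n' N nn'.
have sq k : 0 <= k * k :> int by rewrite -expr2 sqr_ge0.
have n_ge0 : 0 <= n by have := sq (2 * x + y); have := sq y; lia.
have n'_gt0 : 0 < n' by nia.
have n1 : n = 1 by nia.
have y0 : y = 0 by have := sq (2 * x + y); nia.
have [->|->] : x = 1 \/ x = -1 by nia.
  by left; rewrite /zomega y0 mul0r addr0.
by right; rewrite /zomega y0 mul0r addr0.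
Qed.

End RingO11.

(** * Upper triangular isometries *)

Section Matrices.
Variable R : realType.
Local Open Scope ring_scope.
Local Notation C := R[i].

Definition borel (b p z t : C) : 'M[C]_3 := mx3 1 p t 0 b z 0 0 1.

Lemma ord3P (i : 'I_3) : [\/ i = 0, i = 1 | i = 2].
Proof.
by case: i => [[|[|[|//]]] Hi]; [apply: Or31|apply: Or32|apply: Or33]; apply: val_inj.
Qed.

Lemma mul3E (A B : 'M[C]_3) i j :
  (A *m B) i j = A i 0 * B 0 j + A i 1 * B 1 j + A i 2 * B 2 j.
Proof.
rewrite mxE !big_ord_recl big_ord0 addr0 addrA.
by congr (_ + A _ _ * B _ _ + A _ _ * B _ _); apply: val_inj.
Qed.

Lemma mulvec3E (A : 'M[C]_3) (v : 'cV[C]_3) i :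
  (A *m v) i 0 = A i 0 * v 0 0 + A i 1 * v 1 0 + A i 2 * v 2 0.
Proof.
rewrite mxE !big_ord_recl big_ord0 addr0 addrA.
by congr (_ + A _ _ * v _ _ + A _ _ * v _ _); apply: val_inj.
Qed.

Lemma borelM b p z t b' p' z' t' :
  borel b p z t *m borel b' p' z' t' =
  borel (b * b') (p' + p * b') (b * z' + z) (t' + p * z' + t).
Proof.
apply/matrixP => i j; rewrite mul3E.
by case: (ord3P i) => ->; case: (ord3P j) => ->; rewrite /borel !mxE /=; ring.
Qed.

Lemma borel1 : borel 1 0 0 0 = 1%:M.
Proof.
by apply/matrixP => i j; case: (ord3P i) => ->; case: (ord3P j) => ->; rewrite !mxE.
Qed.

Lemma borel_inj b p z t b' p' z' t' :
  borel b p z t = borel b' p' z' t' -> [/\ b = b', p = p', z = z' & t = t'].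
Proof.
move/matrixP => E; split.
- by have := E 1 1; rewrite !mxE.
- by have := E 0 1; rewrite !mxE.
- by have := E 1 2; rewrite !mxE.
by have := E 0 2; rewrite !mxE.
Qed.

(** Isometry spelled out on two basis vectors: the antidiagonal form pairs the
    i-th one with the one of index [rev_ord i]. *)
Lemma unitary_entries (A : 'M[C]_3) i j : A \in @unitary21 R ->
  A 0 i * (A 2 j)^*%C + A 1 i * (A 1 j)^*%C + A 2 i * (A 0 j)^*%C =
  (i == rev_ord j)%:R.
Proof.
move=> /unitary21P/(_ (delta_mx i 0) (delta_mx j 0)).
by rewrite herm_deltal -!colE /herm !mxE andbT conjc_nat (inv_eq (@rev_ordK 3)).
Qed.

Lemma borel_unitary b p z t : b = 1 \/ b = -1 ->
  p = - (b * z^*%C) -> t + t^*%C = - (z * z^*%C) -> borel b p z t \in @unitary21 R.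
Proof.
move=> Hb Hp Ht; apply/unitary21P => u v.
have bb : b * b = 1 by case: Hb => ->; rewrite ?mulrNN mulr1.
have bJ : b^*%C = b by case: Hb => ->; rewrite ?rmorphN rmorph1.
have pJ : p^*%C = - (b * z) by rewrite Hp rmorphN rmorphM /= conjcK bJ.
have tJ : t^*%C = - (z * z^*%C) - t by rewrite -Ht addrC addKr.
rewrite /herm !mulvec3E /borel !mxE /=.
rewrite !(mul0r, mul1r, add0r) !(rmorphD, rmorphM) /= bJ pJ tJ Hp.
ring: bb.
Qed.

Lemma expi_pi : expi pi = -1 :> C.
Proof. by rewrite /expi cospi sinpi; apply/eqP; rewrite eq_complex /= oppr0 !eqxx. Qed.

Section Represents.
Implicit Types (A B : 'M[C]_3) (g h : Gamma11_inf R).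

Lemma represents_inj A g h : represents A g -> represents A h -> g = h.
Proof.
move=> [U [UA Ug]] [V [VA Vh]]; apply: val_inj; apply: val_inj.
by rewrite /= -Ug -Vh; congr (class_of _ _); apply: val_inj; rewrite /= UA VA.
Qed.

Lemma represents1 : represents 1%:M (1%g : Gamma11_inf R).
Proof. by exists 1%g. Qed.

Lemma representsM A B g h :
  represents A g -> represents B h -> represents (A *m B) (g * h)%g.
Proof.
move=> [U [<- Ug]] [V [<- Vh]]; exists (U * V)%g; split=> //.
by rewrite class_ofM Ug Vh.
Qed.

Lemma represents_cancel A B g h :
  represents A g -> represents (A *m B) (g * h)%g -> represents B h.
Proof.
move=> [U [UA Ug]] [V [VA Vgh]]; exists (U^-1 * V)%g; split.
  by rewrite umxM umxV VA UA mulKmx // -UA unitary21_unit // umxP.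
by rewrite class_ofM class_ofV Ug Vgh /= mulKg.
Qed.

(** The scalar -1 = expi pi lies in U(1). *)
Lemma represents_opp A g : represents A g -> represents (- A) g.
Proof.
move=> [U [<- Ug]].
have NU : - umx U \in @unitary21 R.
  apply/unitary21P => u v; have /unitary21P/(_ u v) <- := umxP U.
  rewrite !mulNmx; move: (_ *m u) (_ *m v) => u' v'.
  by rewrite /herm !mxE !rmorphN /= !mulrNN.
exists (MkU21 NU); split=> //; rewrite -Ug.
apply/esym/class_ofP/u1P; exists pi.
rewrite umxM umxV /= mulmxN mulVmx ?unitary21_unit ?umxP //.
by rewrite expi_pi raddfN.
Qed.

(** Two matrices of the same class differ by a scalar, which is 1 as both have
    upper left entry 1. *)
Lemma represents_borel_inj b p z t b' p' z' t' g :
  represents (borel b p z t) g -> represents (borel b' p' z' t') g ->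
  borel b p z t = borel b' p' z' t'.
Proof.
move=> [U [UA Ug]] [V [VA Vg]].
have /class_ofP/u1P[s] : class_of (U1 R) U = class_of (U1 R) V by rewrite Ug Vg.
move=> Es; have E : borel b' p' z' t' = expi s *: borel b p z t.
  by rewrite -UA -VA -[V](mulVKg U) umxM Es mul_mx_scalar.
have : expi s = 1 by have /matrixP/(_ 0 0) := E; rewrite !mxE /= mulr1.
by move=> s1; rewrite E s1 scale1r.
Qed.

(** Negative powers need no inverse matrix: the recurrence can be cancelled
    backwards. *)
Lemma represents_zpow (A : int -> 'M[C]_3) g n : A 0 = 1%:M ->
  (forall n, A (n + 1) = A 1 *m A n) -> represents (A 1) g ->
  represents (A n) (zpow g n).
Proof.
move=> A0 AS Ag; elim/int_ind: n => [|k IH|k IH].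
- by rewrite A0; apply: represents1.
- by rewrite -addn1 PoszD AS zpowS; apply: representsM.
apply: (represents_cancel Ag); rewrite -AS -zpowS.
by have -> : (- k.+1%:Z + 1 = - k%:Z)%R by lia.
Qed.

Lemma borel_represents b p z t : borel b p z t \in @unitary21 R ->
  b \in @O11 R -> p \in @O11 R -> z \in @O11 R -> t \in @O11 R ->
  exists g : Gamma11_inf R, represents (borel b p z t) g.
Proof.
move=> HU Ob Op Oz Ot; pose U := MkU21 HU.
have HG : class_of (U1 R) U \in Subgroup (@gamma11_group R).
  apply/gamma11P; exists U; split=> // i j.
  by case: (ord3P i) => ->; case: (ord3P j) => ->; rewrite !mxE //=;
    [exact: (O11_int R 1)|exact: (O11_int R 0)..|exact: (O11_int R 1)].
have HS : Subg HG \in Subgroup (@stab_qinf_group R).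
  apply/eqP; rewrite /= pactE; apply/point_ofP; exists 1; first exact: oner_neq0.
  rewrite scale1r /=; apply/colP => i; rewrite mulvec3E.
  by case: (ord3P i) => ->; rewrite /borel !mxE /= ?mulr0 ?mulr1 ?mul0r ?mul1r ?addr0.
by exists (Subg HS), U.
Qed.

(** Fixing q_infty makes the first column a multiple of the first basis vector;
    the isometry equations then give the remaining zeros and show that the
    diagonal entries are units of O_11.  The upper left one can be made 1
    without leaving the class, by a change of sign. *)
Lemma stabilizer_borel g : exists b z t,
  [/\ represents (borel b (- (b * z^*%C)) z t) g, b = 1 \/ b = -1,
      z \in @O11 R, t \in @O11 R & t + t^*%C = - (z * z^*%C)].
Proof.
have /gamma11P[U [Ug UO]] := sgvalP (sgval g).
have := sgvalP g => /eqP; rewrite /= -Ug pactE => /esym/point_ofP[c _ /= Uc].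
have col0 i : umx U i 0 = c * (i == 0)%:R.
  have /colP/(_ i) := Uc.
  by rewrite -colE !mxE eqxx andbT.
have ent i j := unitary_entries i j (umxP U).
have U10 : umx U 1 0 = 0 by rewrite col0 mulr0.
have U20 : umx U 2 0 = 0 by rewrite col0 mulr0.
have U1_1 : umx U 0 0 * (umx U 2 2)^*%C = 1.
  by have := ent 0 2; rewrite U10 U20 !mul0r !addr0.
have {Uc col0 c ent} [V [Vg VO V10 V20 V00]] : exists V : U21 R,
    [/\ class_of (U1 R) V = sgval (sgval g), forall i j, umx V i j \in @O11 R,
        umx V 1 0 = 0, umx V 2 0 = 0 & umx V 0 0 = 1].
  have [U00|U00] := O11_unit (UO 0 0) (O11_conj (UO 2 2)) U1_1; first by exists U.
  have [V [VE Vg]] := represents_opp (ex_intro _ U (conj erefl Ug) : represents (umx U) g).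
  exists V; split=> // [i j|||]; rewrite VE mxE ?U10 ?U20 ?U00 ?oppr0 ?opprK //.
  by rewrite -mulN1r O11M //; apply: (O11_int R (-1)).
have ent i j := unitary_entries i j (umxP V).
have V22 : umx V 2 2 = 1.
  apply: (can_inj (@conjcK R)); rewrite conjc1.
  by have := ent 0 2; rewrite V10 V20 V00 !mul0r !addr0 mul1r.
have V21 : umx V 2 1 = 0.
  apply: (can_inj (@conjcK R)); rewrite conjc0.
  by have := ent 0 1; rewrite V10 V20 V00 !mul0r !addr0 mul1r.
have bb : umx V 1 1 * (umx V 1 1)^*%C = 1.
  by have := ent 1 1; rewrite V21 mul0r addr0 conjc0 mulr0 add0r.
have pz : umx V 0 1 + umx V 1 1 * (umx V 1 2)^*%C = 0.
  by have := ent 1 2; rewrite V21 mul0r addr0 V22 conjc1 mulr1.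
have tt : umx V 0 2 + umx V 1 2 * (umx V 1 2)^*%C + (umx V 0 2)^*%C = 0.
  by have := ent 2 2; rewrite V22 conjc1 mulr1 mul1r.
have VE : umx V = borel (umx V 1 1) (umx V 0 1) (umx V 1 2) (umx V 0 2).
  apply/matrixP => i j.
  by case: (ord3P i) => ->; case: (ord3P j) => ->; rewrite [RHS]mxE.
exists (umx V 1 1), (umx V 1 2), (umx V 0 2); split=> //.
- exists V; split=> //; rewrite {1}VE; congr (borel _ _ _ _).
  by apply/eqP; rewrite -addr_eq0 pz.
- by apply: O11_unit bb => //; apply: O11_conj.
by apply/eqP; rewrite -addr_eq0 addrAC tt.
Qed.

End Represents.
End Matrices.

(** * The stabiliser in coordinates *)

Section Heisenberg.
Variable R : realType.
Local Open Scope ring_scope.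
Local Notation C := R[i].
Local Notation w := (omega11 R).

(** The upper right entry of A^x C^y T^k, for A = R2 R1 and C = R3 R1.  The
    upper right entries of A and C are omega - 1 and omega - 2; the quadratic
    terms accumulate the cross terms - conj(z) z' of successive products. *)
Definition height (x y k : int) : C :=
  - (x%:~R * (1 - w)) - x%:~R * (x%:~R - 1) / 2
  - y%:~R * (2 - w) - 3 * (y%:~R * (y%:~R - 1)) / 2
  - x%:~R * y%:~R * w + k%:~R * (2 * w - 1).

Definition sign_of (e : bool) : C := if e then -1 else 1.

(** The matrix of A^x C^y T^k R1^e. *)
Definition heis (x y k : int) (e : bool) : 'M[C]_3 :=
  borel (sign_of e) (- (sign_of e * (zomega R x y)^*%C)) (zomega R x y) (height x y k).

(** Moving the factor C^y of the first matrix past A^x' creates T^(y x'),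
    which is the matrix form of [transl_commutator]. *)
Lemma heisM x y k x' y' k' e :
  heis x y k false *m heis x' y' k' e = heis (x + x') (y + y') (k + k' + y * x') e.
Proof.
have ww := omega11_sqr R.
rewrite /heis borelM !conj_zomega /height /zomega !(rmorphD, rmorphM) /=.
congr (borel _ _ _ _); [by rewrite mul1r | by ring | by ring | by field: ww].
Qed.

Lemma heis1 : heis 0 0 0 false = 1%:M.
Proof.
rewrite -borel1 /heis conj_zomega /height /zomega; congr (borel _ _ _ _) => /=; ring.
Qed.

Lemma heis_inj x y k e : heis x y k e = 1%:M -> [/\ x = 0, y = 0, k = 0 & e = false].
Proof.
rewrite -borel1 => /borel_inj [e1 _ /zomega_eq0 [-> ->] t0]; split=> //.
  move/eqP: t0; rewrite /height !mul0r !mulr0 !mul0r !subr0 oppr0 add0r.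
  by rewrite mulf_eq0 (negPf (twice_omega11_sub1_neq0 R)) orbF intr_eq0 => /eqP.
case: e e1 => // /eqP; rewrite /= -subr_eq0 -opprD oppr_eq0.
by rewrite (_ : 1 + 1 = 2%:R) // pnatr_eq0.
Qed.

(** Writing t = m + n omega, the hypothesis reads 2m + n = -(x^2 + xy + 3y^2),
    so m determines n, and comparing coefficients gives
    k = - m - x(x+1)/2 - y(y+1)/2 - y^2. *)
Lemma height_surj (x y : int) t : t \in @O11 R ->
  t + t^*%C = - (zomega R x y * (zomega R x y)^*%C) -> exists k, t = height x y k.
Proof.
have ww := omega11_sqr R; move=> /O11_zomega[m [n ->]]; rewrite !conj_zomega /zomega => E.
have {E} nE : n = - (x * x + x * y + 3 * y * y) - 2 * m.
  apply/eqP; rewrite -(eqr_int C) !(rmorphD, rmorphM, rmorphN) /=; apply/eqP.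
  have -> : n%:~R = (m%:~R + n%:~R * w + (m%:~R + n%:~R * (1 - w))) - 2 * m%:~R :> C.
    by ring.
  by rewrite E; ring: ww.
(* [u] stands for a(a+1)/2, in a form that can serve as a rewriting rule. *)
have half (a : int) : exists u : int, a * a = 2 * u - a.
  have := divz_eq a 2; have := modz_ge0 a (isT : 2 != 0 :> int).
  have := ltz_mod a (isT : 2 != 0 :> int); move: (a %/ 2)%Z (a %% 2)%Z => q s ? ? ->.
  have [->|->] : s = 0 \/ s = 1 by lia.
    by exists (2 * q * q + q); ring.
  by exists (2 * q * q + 3 * q + 1); ring.
have [[u xx] [v yy]] := (half x, half y).
exists (- u - v - y * y - m).
have {}xx : x%:~R * x%:~R = 2 * u%:~R - x%:~R :> C by rewrite -rmorphM xx; ring.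
have {}yy : y%:~R * y%:~R = 2 * v%:~R - y%:~R :> C by rewrite -rmorphM yy; ring.
rewrite nE /height !(rmorphD, rmorphM, rmorphN) /=.
by field: ww xx yy.
Qed.

Lemma R1_heis : R1_mx R = heis 0 0 0 true.
Proof.
rewrite /heis conj_zomega /zomega /height /R1_mx; congr (borel _ _ _ _) => /=; ring.
Qed.

Lemma R2R1_heis : R2_mx R *m R1_mx R = heis 1 0 0 false.
Proof.
rewrite [LHS]borelM /heis conj_zomega conj_omega11 /zomega /height.
congr (borel _ _ _ _) => /=; ring.
Qed.

Lemma R3R1_heis : R3_mx R *m R1_mx R = heis 0 1 0 false.
Proof.
rewrite [LHS]borelM /heis conj_zomega conj_omega11 /zomega /height.
congr (borel _ _ _ _) => /=; ring.
Qed.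

Lemma T_heis : T_mx R = heis 0 0 1 false.
Proof.
rewrite /heis conj_zomega /zomega /height /T_mx sqrtN11; congr (borel _ _ _ _) => /=; ring.
Qed.

Lemma T_commute_R1 : T_mx R *m R1_mx R = R1_mx R *m T_mx R.
Proof. by rewrite [LHS]borelM [RHS]borelM; congr (borel _ _ _ _); ring. Qed.

Lemma R1_sqr : R1_mx R *m R1_mx R = 1%:M.
Proof. by rewrite [LHS]borelM -borel1; congr (borel _ _ _ _); ring. Qed.

Lemma R2_sqr : R2_mx R *m R2_mx R = T_mx R.
Proof.
by rewrite [LHS]borelM conj_omega11 /T_mx sqrtN11; congr (borel _ _ _ _); ring.
Qed.

Lemma R3_sqr : R3_mx R *m R3_mx R = T_mx R.
Proof.
have ww := omega11_sqr R.
by rewrite [LHS]borelM conj_omega11 /T_mx sqrtN11; congr (borel _ _ _ _); ring: ww.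
Qed.

Lemma R1R3R2_sqr : let M := R1_mx R *m R3_mx R *m R2_mx R in M *m M = T_mx R.
Proof.
have ww := omega11_sqr R.
rewrite /= [R1_mx R *m _]borelM [_ *m R2_mx R]borelM [LHS]borelM conj_omega11.
by rewrite /T_mx sqrtN11; congr (borel _ _ _ _); ring: ww.
Qed.

Section Generators.
Variable r : 'I_4 -> Gamma11_inf R.
Hypotheses (H1 : represents (R1_mx R) (r 0)) (H2 : represents (R2_mx R) (r 1))
  (H3 : represents (R3_mx R) (r 2)) (HT : represents (T_mx R) (r 3)).

Lemma generators_relations : relations r.
Proof.
split; rewrite ?expg2.
- by apply: (represents_inj (representsM H1 H1)); rewrite R1_sqr; apply: represents1.
- by apply: (represents_inj (representsM HT H1)); rewrite T_commute_R1; apply: representsM.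
- by apply: (represents_inj HT); rewrite -R2_sqr; apply: representsM.
- by apply: (represents_inj HT); rewrite -R3_sqr; apply: representsM.
by apply: (represents_inj HT); rewrite -R1R3R2_sqr; do ![apply: representsM].
Qed.

Lemma represents_normal_form x y k e : represents (heis x y k e) (normal_form r x y k e).
Proof.
have Ha : represents (heis x 0 0 false) (zpow (transl1 r) x).
  apply: (represents_zpow (A := fun n => heis n 0 0 false)) => [|n|].
  - exact: heis1.
  - by rewrite heisM; congr heis; ring.
  by rewrite -R2R1_heis; apply: representsM.
have Hc : represents (heis 0 y 0 false) (zpow (transl2 r) y).
  apply: (represents_zpow (A := fun n => heis 0 n 0 false)) => [|n|].
  - exact: heis1.
  - by rewrite heisM; congr heis; ring.
  by rewrite -R3R1_heis; apply: representsM.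
have Ht : represents (heis 0 0 k false) (zpow (r 3) k).
  apply: (represents_zpow (A := fun n => heis 0 0 n false)) => [|n|].
  - exact: heis1.
  - by rewrite heisM; congr heis; ring.
  by rewrite -T_heis.
have He : represents (heis 0 0 0 e) (r 0 ^+ e)%g.
  rewrite expgb; case: e; first by rewrite -R1_heis.
  by rewrite heis1; apply: represents1.
have := representsM (representsM (representsM Ha Hc) Ht) He; rewrite !heisM.
by congr (represents (heis _ _ _ _) _); ring.
Qed.

(** This yields both that the generators generate and that the presented group
    maps onto the stabiliser. *)
Lemma stabilizer_normal_form g : exists x y k e, g = normal_form r x y k e.
Proof.
have [b [z [t [Hg Hb /O11_zomega[x [y zE]] Ot tE]]]] := stabilizer_borel g; subst z.
have [k tk] := height_surj Ot tE.
have Hn e := represents_normal_form x y k e; rewrite tk in Hg.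
exists x, y, k; case: Hb Hg => -> Hg; [exists false|exists true].
  exact: represents_inj Hg (Hn false).
exact: represents_inj Hg (Hn true).
Qed.

End Generators.

Lemma exists_generators : exists r : 'I_4 -> Gamma11_inf R,
  [/\ represents (R1_mx R) (r 0), represents (R2_mx R) (r 1),
      represents (R3_mx R) (r 2) & represents (T_mx R) (r 3)].
Proof.
have ww := omega11_sqr R.
have conjN z : (- z)^*%C = - z^*%C :> C by apply: rmorphN.
have conjB z z' : (z - z')^*%C = z^*%C - z'^*%C :> C by apply: rmorphB.
have conjM z z' : (z * z')^*%C = z^*%C * z'^*%C :> C by apply: rmorphM.
have O0 : 0 \in @O11 R by apply: (O11_int R 0).
have O1 : 1 \in @O11 R by apply: (O11_int R 1).
have ON1 : -1 \in @O11 R by apply: (O11_int R (-1)).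
have Ow : w \in @O11 R by apply/O11P; exists 'X; rewrite map_polyX hornerX.
have OwJ := O11_conj Ow.
have ON z : z \in @O11 R -> - z \in @O11 R by rewrite -mulN1r; apply: O11M.
have Os : 2 * w - 1 \in @O11 R.
  by apply: O11D => //; apply: O11M => //; apply: (O11_int R 2).
have [g1 H1] : exists g : Gamma11_inf R, represents (R1_mx R) g.
  apply: borel_represents => //; apply: borel_unitary; first by right.
    by rewrite conjc0; ring.
  by rewrite conjc0; ring.
have [g2 H2] : exists g : Gamma11_inf R, represents (R2_mx R) g.
  apply: borel_represents; rewrite ?ON //; apply: borel_unitary; first by right.
    by rewrite conjc1; ring.
  by rewrite conj_omega11 conjN conjB conjc1 conj_omega11; ring.
have [g3 H3] : exists g : Gamma11_inf R, represents (R3_mx R) g.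
  apply: borel_represents => //; last by rewrite O11D // ON.
  apply: borel_unitary; first by right.
    by ring.
  by rewrite conj_omega11 !(conjB, conjN) conjc1 conj_omega11; ring: ww.
have [t Ht] : exists g : Gamma11_inf R, represents (T_mx R) g.
  apply: borel_represents => //; last by rewrite sqrtN11.
  apply: borel_unitary; first by left.
    by rewrite conjc0; ring.
  by rewrite sqrtN11 conjB conjM conjc1 conjc0 conjc_nat conj_omega11; ring.
by exists (fun i : 'I_4 => nth g1 [:: g1; g2; g3; t] i).
Qed.

End Heisenberg.

(** * The presentation *)

Lemma normal_form_morph (G H : groupType) (f : UMagmaMorphism.type G H)
    (s : 'I_4 -> G) (r : 'I_4 -> H) x y k e : (forall i, f (s i) = r i) ->
  f (normal_form s x y k e) = normal_form r x y k e.
Proof.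
by move=> fs; rewrite /normal_form !gmulfM gmulfXn !zpow_morph /transl1 /transl2 !gmulfM !fs.
Qed.

Theorem proposition3p4 (R : realType) :
  exists r : 'I_4 -> Gamma11_inf R,
    [/\ represents (R1_mx R) (r 0%R), represents (R2_mx R) (r 1%R),
        represents (R3_mx R) (r 2%R) & represents (T_mx R) (r 3%R)]
    /\ generates r
    /\ presents relators r.
Proof.
have [r [H1 H2 H3 Ht]] := exists_generators R; exists r.
split; first by [].
have nf_surj g := stabilizer_normal_form H1 H2 H3 Ht g.
split=> [H Hr g|]; first by have [x [y [k [e ->]]]] := nf_surj g; apply: normal_form_closed.
have /(relationsP (free_eval_gen r)) rels := generators_relations H1 H2 H3 Ht.
have [f fr] := presented_lift rels.
exists f; split=> //.
pose N := normal_closure (fun w => w \in relators).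
pose s i : presented relators := class_of N (fgen i).
have s_rels : relations s.
  apply/(relationsP (f := class_of N)) => // w w_rel.
  rewrite -(class_of1 N); apply/esym/class_ofP; rewrite invg1 mul1g.
  by apply/normal_closureP => M; apply.
have f_inj : injective f.
  apply: gmulf_inj => p.
  have [x [y [k [e ->]]]] := normal_form_cover s_rels (@presented_generated _ _) p.
  rewrite (normal_form_morph _ _ _ _ fr) => fp.
  have := represents_normal_form H1 H2 H3 Ht x y k e; rewrite fp => Hp.
  (* The identity and the kernel element are compared as matrices; all four
     coordinates of the latter vanish. *)
  have H1g : represents (heis R 0 0 0 false) (1%g : Gamma11_inf R).
    by rewrite heis1; apply: represents1.
  have E : heis R x y k e = heis R 0 0 0 false := represents_borel_inj Hp H1g.
  move: E; rewrite heis1 => /heis_inj [-> -> -> ->].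
  by rewrite /normal_form /= !mulg1.
have f_surj g : exists p, f p == g.
  have [x [y [k [e ->]]]] := nf_surj g; exists (normal_form s x y k e).
  by rewrite (normal_form_morph _ _ _ _ fr).
exists (fun g => xchoose (f_surj g)) => [p|g]; last exact/eqP/(xchooseP (f_surj g)).
by apply/f_inj/eqP/(xchooseP (f_surj (f p))).
Qed.
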